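(* Let $\mathcal{X}\subseteq\mathbb{R}^d$, $\mathcal{Y}=[K]$, consider an $\ell_p$ norm with $p\in(1,\infty]$, and let $\epsilon>0$. For any $\mu\in\mathcal{P}(\mathcal{X}\times\mathcal{Y})$ with support $s_\mu$ and probability vector $\boldsymbol{\omega}_\mu$, $$1-\mathcal{R}^*_{\mathcal{F}_{\mathrm{rand}}}(\mu,\epsilon)=\mathrm{FP}(H_{s_\mu}^\epsilon,\boldsymbol{\omega}_\mu).$$
   Context: Notation: $[K]=\{1,\dots,K\}$; $\Delta^n=\{u\in\mathbb{R}_+^n:\sum_i u^{(i)}=1\}$; $B_p(x,\epsilon)=\{x'\in\mathcal{X}:\|x'-x\|_p\le\epsilon\}$. $\mathcal{P}(\mathcal{Z})$ is the set of probability distributions with finite support on $\mathcal{Z}$; a distribution $\mu\in\mathcal{P}(\mathcal{Z})$ is described by its support $s_\mu=(z_1,\dots,z_n)$ (distinct points) and its probability vector $\boldsymbol{\omega}_\mu\in\Delta^n$, assigning mass $\boldsymbol{\omega}_\mu^{(i)}$ to $z_i$. $\mathcal{F}_{\mathrm{rand}}$ is the set of all functions $f:\mathcal{X}\to\mathcal{P}(\mathcal{Y})$, and $$\mathcal{R}^*_{\mathcal{F}_{\mathrm{rand}}}(\mu,\epsilon)=\inf_{f\in\mathcal{F}_{\mathrm{rand}}}\mathbb{E}_{(x,y)\sim\mu}\Big[\sup_{x'\in B_p(x,\epsilon)}\mathbb{E}_{z\sim f(x')}[\mathbf{1}\{z\neq y\}]\Big].$$ Conflict hypergraph: for $s_\mu=\{(x_i,y_i)\}_{i\in[n]}$,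 the conflict hypergraph $H_{s_\mu}^\epsilon$ has vertex set $[n]$, and a nonempty $e\subseteq[n]$ is a hyperedge iff (1) $y_i\neq y_j$ for all distinct $i,j\in e$, and (2) $\bigcap_{i\in e}B_p(x_i,\epsilon)\neq\emptyset$. Fractional set packing: for a hypergraph $H=([n],\mathcal{E})$ and $\boldsymbol{\omega}\in\mathbb{R}_+^n$, $\mathcal{Q}^{\mathrm{frac}}(H)=\{q\in[0,1]^n:\sum_{i\in e}q^{(i)}\le1\ \forall e\in\mathcal{E}\}$ and $\mathrm{FP}(H,\boldsymbol{\omega})=\max_{q\in\mathcal{Q}^{\mathrm{frac}}(H)}\boldsymbol{\omega}^Tq$. *)

(* Defs.v *)
From mathcomp Require Import all_boot all_order all_algebra.
From mathcomp Require Import all_classical all_reals all_analysis.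
Set Implicit Arguments.
Unset Strict Implicit.
Unset Printing Implicit Defensive.
Import Order.TTheory GRing.Theory Num.Theory.
Import numFieldNormedType.Exports.
Local Open Scope classical_set_scope.
Local Open Scope ring_scope.

(* The case [-oo] is a dummy value; only [1 < p] is used. *)
Definition lpnorm (R : realType) (d : nat) (p : \bar R) (v : 'rV[R]_d) : R :=
  match p with
  | r%:E => (\sum_i `|v 0 i| `^ r) `^ r^-1
  | +oo%E => \big[Num.max/0]_i `|v 0 i|
  | -oo%E => 0
  end.

(* A set [X : set 'rV[R]_d] is coerced to the type of its points, so balls are
   taken inside [X]. *)
Definition lpball (R : realType) (d : nat) (X : set 'rV[R]_d) (p : \bar R)
    (x : X) (eps : R) : set X :=
  [set x' : X | lpnorm p (\val x' - \val x) <= eps].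

Definition simplex (R : realType) (n : nat) : set 'rV[R]_n :=
  [set u | (forall i, 0 <= u 0 i) /\ \sum_i u 0 i = 1].

(* Null masses are permitted: [probs] ranges over the whole simplex. *)
Record fin_distr (R : realType) (Z : Type) := FinDistr {
  supp_size : nat;
  supp : 'I_supp_size -> Z;
  probs : 'rV[R]_supp_size;
  supp_inj : injective supp;
  probs_simplex : simplex probs }.
Arguments supp {R Z} mu i : rename.

Definition expect (R : realType) (Z : Type) (mu : fin_distr R Z) (g : Z -> R)
    : R :=
  \sum_i probs mu 0 i * g (supp mu i).

Section Risk.
Variables (R : realType) (d K : nat) (X : set 'rV[R]_d).

Definition classifier := X -> fin_distr R 'I_K.

Definition adv_risk (p : \bar R) (mu : fin_distr R (X * 'I_K)) (eps : R)
    (f : classifier) : R :=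
  expect mu (fun xy =>
    sup [set expect (f x') (fun z => (z != xy.2)%:R)
        | x' in lpball p xy.1 eps]).

Definition optimal_adv_risk (F : set classifier) (p : \bar R)
    (mu : fin_distr R (X * 'I_K)) (eps : R) : R :=
  inf [set adv_risk p mu eps f | f in F].

Definition F_rand : set classifier := [set: classifier].

End Risk.

(* A hypergraph on the vertex set ['I_n] is given by its set of hyperedges. *)
Definition hypergraph (n : nat) := set {set 'I_n}.

Definition conflict_hypergraph (R : realType) (d K : nat) (X : set 'rV[R]_d)
    (p : \bar R) (eps : R) (n : nat) (s : 'I_n -> X * 'I_K) : hypergraph n :=
  [set e | [/\ (0 < #|e|)%N,
     {in e &, forall i j, i != j -> (s i).2 != (s j).2} &
     \bigcap_(i in [set` e]) lpball p (s i).1 eps !=set0]].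

Definition Qfrac (R : realType) (n : nat) (H : hypergraph n) : set 'rV[R]_n :=
  [set q | (forall i, 0 <= q 0 i <= 1) /\
           (forall e, H e -> \sum_(i in e) q 0 i <= 1)].
Arguments Qfrac R {n} H.

Definition FP (R : realType) (n : nat) (H : hypergraph n) (w : 'rV[R]_n) : R :=
  sup [set \sum_i w 0 i * q 0 i | q in Qfrac R H].

Lemma compact_Qfrac (R : realType) (n : nat) (H : hypergraph n) :
  compact (Qfrac R H).
Proof.
have cc : compact [set v : 'rV[R]_n | forall i, v ord0 i \in `[(0 : R), 1]].
  apply: (@rV_compact _ _ (fun=> `[(0 : R), 1]%classic)).
  by move=> _; apply: segment_compact.
apply: subclosed_compact cc _; last first.
  by move=> q [q01 _] i /=; rewrite in_itv /= q01.
have -> : Qfrac R H =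
    (\bigcap_(i in [set: 'I_n]) (fun q : 'rV[R]_n => q 0 i) @^-1` [set` `[0, 1]%R]) `&`
    (\bigcap_(e in H) (fun q : 'rV[R]_n => \sum_(i in e) q 0 i) @^-1`
      [set x | x <= 1]).
  apply/seteqP; split=> q [q01 qH]; split.
  - by move=> i _ /=; rewrite in_itv /= q01.
  - by move=> e He /=; exact: qH.
  - by move=> i; have := q01 i I; rewrite /= in_itv.
  - by move=> e He; exact: qH.
apply: closedI; apply: closed_bigI => j _; apply: preimage_closed.
- by move=> q _; exact: coord_continuous.
- exact: itv_closed.
- move=> q _; apply: (continuous_big add_continuous) => i _.
  exact: coord_continuous.
- exact: closed_le.
Qed.

(* The supremum defining [FP] is a maximum. *)
Lemma FP_max (R : realType) (n : nat) (H : hypergraph n) (w : 'rV[R]_n) :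
  (exists2 q, Qfrac R H q & FP H w = \sum_i w 0 i * q 0 i) /\
  (forall q, Qfrac R H q -> \sum_i w 0 i * q 0 i <= FP H w).
Proof.
pose g (q : 'rV[R]_n) := \sum_i w 0 i * q 0 i.
have Q0 : Qfrac R H 0.
  split=> [i|e _]; first by rewrite mxE lexx ler01.
  by rewrite big1 ?ler01// => i _; rewrite mxE.
have cg : continuous g.
  apply: (continuous_big add_continuous) => i _ q.
  by apply: (@continuousM _ _ (cst (w 0 i)) (fun q : 'rV[R]_n => q 0 i));
    [exact: cst_continuous|exact: coord_continuous].
have [c /set_mem Qc cmax] : exists2 c, c \in Qfrac R H &
    forall q, q \in Qfrac R H -> g q <= g c.
  apply: compact_EVT_max; [by exists 0|exact: compact_Qfrac|].
  exact: continuous_subspaceT.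
have ub : ubound [set g q | q in Qfrac R H] (g c).
  by move=> _ [q Qq <-]; apply: cmax; exact: mem_set.
have FPE : FP H w = g c.
  apply/eqP; rewrite eq_le; apply/andP; split.
    by apply: ge_sup => //; exists (g c), c.
  have hub : has_ubound [set g q | q in Qfrac R H] by exists (g c).
  by apply: (ub_le_sup hub); exists c.
split; first by exists c.
by move=> q Qq; rewrite FPE; apply: cmax; exact: mem_set.
Qed.

(* Main.v *)
(* A randomized classifier f yields the packing q_i = inf of the mass f(x')(y_i)
   over the ball of x_i, i.e. one minus the i-th adversarial loss: at a common
   point of the balls of a hyperedge the labels are distinct, so the masses sum
   to at most 1.  Conversely, given a packing q, let f(x') put on the label y
   the largest q_i with y_i = y and x' in the ball of x_i; the maximizers for
   the various labels form a hyperedge, so the total mass is at most 1, and the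
   missing mass can be put on any label. *)
Require Import Defs.
From mathcomp Require Import all_boot all_order all_algebra.
From mathcomp Require Import all_classical all_reals all_analysis.
From mathcomp Require Import lra.
Import Order.TTheory GRing.Theory Num.Theory.
Import numFieldNormedType.Exports.
Local Open Scope classical_set_scope.
Local Open Scope ring_scope.

Lemma lpnorm0 (R : realType) (d : nat) (p : \bar R) :
  (1 < p)%E -> lpnorm p (0 : 'rV[R]_d) = 0.
Proof.
case: p => [r| |] //=.
  rewrite lte_fin => r1; have r0 : r != 0 by rewrite gt_eqF // (lt_trans ltr01).
  rewrite big1 ?powR0 ?invr_neq0 // => i _.
  by rewrite mxE normr0 powR0.
move=> _; elim/big_ind: _ => // [x y -> ->|i _]; first by rewrite maxxx.
by rewrite mxE normr0.
Qed.

Lemma lpball_center {R : realType} {d : nat} {X : set 'rV[R]_d} {p : \bar R}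
    (x : X) {eps : R} :
  (1 < p)%E -> 0 <= eps -> lpball p x eps x.
Proof. by move=> p1 eps0; rewrite /lpball /= subrr lpnorm0. Qed.

Section Expect.
Context {R : realType}.

Lemma expect_ge0 {Z : Type} (nu : fin_distr R Z) (g : Z -> R) :
  (forall z, 0 <= g z) -> 0 <= expect nu g.
Proof.
move=> g0; apply: sumr_ge0 => i _; apply: mulr_ge0 => //.
by have [+ _] := probs_simplex nu; apply.
Qed.

Lemma ler_expect {Z : Type} (nu : fin_distr R Z) (g h : Z -> R) :
  (forall z, g z <= h z) -> expect nu g <= expect nu h.
Proof.
move=> gh; apply: ler_sum => i _; apply: ler_wpM2l => //.
by have [+ _] := probs_simplex nu; apply.
Qed.

Lemma expect_cst {Z : Type} (nu : fin_distr R Z) (c : R) :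
  expect nu (fun=> c) = c.
Proof.
by rewrite /expect -mulr_suml; have [_ ->] := probs_simplex nu; rewrite mul1r.
Qed.

Lemma expect_sum {Z : Type} (nu : fin_distr R Z) (I : finType) (P : pred I)
    (g : I -> Z -> R) :
  \sum_(i | P i) expect nu (g i) = expect nu (fun z => \sum_(i | P i) g i z).
Proof.
by rewrite /expect exchange_big; apply: eq_bigr => k _; rewrite mulr_sumr.
Qed.

Lemma expect_neq {Z : eqType} (nu : fin_distr R Z) (y : Z) :
  expect nu (fun z => (z != y)%:R) = 1 - expect nu (fun z => (z == y)%:R).
Proof.
rewrite -[X in X - _](expect_cst nu) /expect -sumrB; apply: eq_bigr => i _.
by case: eqP => _; rewrite ?mulr1 ?mulr0 ?subrr ?subr0.
Qed.

Lemma expect_neq_itv {Z : eqType} (nu : fin_distr R Z) (y : Z) :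
  0 <= expect nu (fun z => (z != y)%:R) <= 1.
Proof.
rewrite expect_ge0 => [|z]; last by rewrite ler0n.
by rewrite -[leRHS](expect_cst nu) ler_expect // => z; rewrite lern1 leq_b1.
Qed.

End Expect.

Section Completion.
Context {R : realType} {K : nat} (y0 : 'I_K) (g : 'I_K -> R).
Hypotheses (g_ge0 : forall y, 0 <= g y) (g_le1 : \sum_y g y <= 1).

Let w : 'rV[R]_K := \row_y (g y + (y == y0)%:R * (1 - \sum_y g y)).

Let w_simplex : simplex w.
Proof.
split=> [y|]; first by rewrite mxE addr_ge0 // mulr_ge0 // subr_ge0.
under eq_bigr do rewrite mxE.
have -> : \sum_y (g y + (y == y0)%:R * (1 - \sum_y g y)) =
    \sum_y g y + (\sum_y (y == y0)%:R) * (1 - \sum_y g y).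
  by rewrite big_split /= mulr_suml.
have -> : \sum_(y < K) (y == y0)%:R = 1 :> R.
  by rewrite (bigD1 y0) //= eqxx big1 ?addr0 // => y /negbTE->.
by rewrite mul1r addrC subrK.
Qed.

Definition complete_distr : fin_distr R 'I_K :=
  FinDistr (fun _ _ h => h) w_simplex.

Lemma complete_distr_ge y :
  g y <= expect complete_distr (fun z => (z == y)%:R).
Proof.
rewrite /expect /= (bigD1 y) //= eqxx mulr1 big1 => [|z /negbTE->].
  by rewrite addr0 mxE lerDl mulr_ge0 // subr_ge0.
by rewrite mulr0.
Qed.

End Completion.

Section LabelMax.
Context {R : realType} {I Y : finType}.
Variables (y : I -> Y) (B : pred I) (q : I -> R).

(** Choosing a single maximizer breaks ties, so each label has at most one representative; [None]
    means that no index in [B] carries the label. *)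
Definition label_argmax (c : Y) : option I :=
  [pick i | [&& y i == c, B i &
    [forall j, (y j == c) && B j ==> (q j <= q i)]]].

(** The default 0 makes absent labels contribute nothing to the total mass. *)
Definition label_max (c : Y) : R := oapp q 0 (label_argmax c).

Definition label_argmaxs : {set I} := [set i | label_argmax (y i) == Some i].

Lemma label_argmax_some c i : label_argmax c = Some i -> y i = c /\ B i.
Proof.
by rewrite /label_argmax; case: pickP => // j /and3P[/eqP yj Bj _] [<-].
Qed.

Lemma label_max_ge i : B i -> q i <= label_max (y i).
Proof.
move=> Bi; rewrite /label_max /label_argmax; case: pickP => [j|nomax] /=.
  by case/and3P=> _ _ /forallP/(_ i); rewrite eqxx Bi.
(* If [pick] fails, [i] is still a candidate, so the finite set of candidates has a maximizer: a
   contradiction. *)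
have Pi : (y i == y i) && B i by rewrite eqxx.
case: (@arg_maxP _ _ _ i (fun j => (y j == y i) && B j) q Pi).
move=> j /andP[yj Bj] jmax.
have /negP[] := negbT (nomax j); rewrite yj Bj /=.
by apply/forallP => k; apply/implyP; apply: jmax.
Qed.

Lemma label_argmaxs_sub i : i \in label_argmaxs -> B i.
Proof. by rewrite inE => /eqP/label_argmax_some[]. Qed.

(** Two members with the same label are both the one index chosen for that label. *)
Lemma label_argmaxs_inj : {in label_argmaxs &, injective y}.
Proof.
by move=> i j; rewrite !inE => /eqP yi /eqP + yij; rewrite -yij yi => -[].
Qed.

(** Grouped by label, the representatives form fibres with one element, or none where [label_max] is
    0. *)
Lemma sum_label_max : \sum_c label_max c = \sum_(i in label_argmaxs) q i.
Proof.
rewrite (partition_big y xpredT) //=; apply: eq_bigr => c _.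
rewrite /label_max; case E: (label_argmax c) => [i|] /=; last first.
  by rewrite big_pred0 // => i; rewrite inE; case: eqP => // + /=;
    case: (y i =P c) => // -> ; rewrite E.
rewrite (big_pred1 i) // => j; rewrite inE /=.
have [yi _] := label_argmax_some _ _ E.
apply/andP/eqP => [[/eqP + /eqP yj]|->]; first by rewrite yj E => -[].
by rewrite yi E.
Qed.

End LabelMax.

Section Packing.
Context {R : realType} {d K : nat} {X : set 'rV[R]_d} {p : \bar R} {eps : R}.
Hypotheses (p1 : (1 < p)%E) (eps0 : 0 <= eps).

(** The integrand of [adv_risk], isolated so that each support point can be bounded separately. *)
Definition adv_loss (f : classifier K X) (xy : X * 'I_K) : R :=
  sup [set expect (f x') (fun z => (z != xy.2)%:R) | x' in lpball p xy.1 eps].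

Lemma adv_loss_ge f xy x' : lpball p xy.1 eps x' ->
  expect (f x') (fun z => (z != xy.2)%:R) <= adv_loss f xy.
Proof.
move=> xx'; apply: ub_le_sup; last by exists x'.
by exists 1 => _ [z _ <-]; have /andP[] := expect_neq_itv (f z) xy.2.
Qed.

Lemma adv_loss_le f xy c :
  (forall x', lpball p xy.1 eps x' ->
    expect (f x') (fun z => (z != xy.2)%:R) <= c) ->
  adv_loss f xy <= c.
Proof.
move=> fc; apply: ge_sup; last by move=> _ [x' xx' <-]; exact: fc.
(* A least upper bound is only usable on a nonempty set; the ball contains its center. *)
by eexists; exists xy.1 => //; exact: lpball_center.
Qed.

Lemma adv_loss_itv f xy : 0 <= adv_loss f xy <= 1.
Proof.
apply/andP; split; last first.
  by apply: adv_loss_le => x' _; have /andP[] := expect_neq_itv (f x') xy.2.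
apply: le_trans (adv_loss_ge _ _ _ (lpball_center xy.1 p1 eps0)).
by have /andP[] := expect_neq_itv (f xy.1) xy.2.
Qed.

Lemma Qfrac_adv_loss f {n : nat} (s : 'I_n -> X * 'I_K) :
  Qfrac R (conflict_hypergraph p eps s) (\row_i (1 - adv_loss f (s i))).
Proof.
split=> [i|e [_ ye [x' ex']]].
  by rewrite mxE; have /andP[] := adv_loss_itv f (s i); lra.
under eq_bigr do rewrite mxE.
(* [m i] is the mass of the [i]-th label at the common point [x'] of the balls; it is at least one
   minus the loss. *)
pose m i := expect (f x') (fun z => (z == (s i).2)%:R).
apply: (@le_trans _ _ (\sum_(i in e) m i)).
  apply: ler_sum => i ie.
  by have := adv_loss_ge f _ _ (ex' i ie); rewrite expect_neq /m; lra.
rewrite expect_sum -[leRHS](expect_cst (f x')) ler_expect // => z.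
(* Labels in [e] are distinct, so at most one indicator is nonzero at [z]. *)
case: (pickP [pred i in e | z == (s i).2]) => [i /= /andP[ie /eqP zi]|no].
  rewrite (bigD1 i) //= zi eqxx big1 ?addr0 // => j /andP[je ji].
  by rewrite eq_sym (negbTE (ye _ _ je ie ji)).
by rewrite big1 // => i ie; have := no i; rewrite /= ie /= => ->.
Qed.

Lemma classifier_of_packing {n : nat} (s : 'I_n -> X * 'I_K) (y0 : 'I_K)
    (q : 'rV[R]_n) :
  Qfrac R (conflict_hypergraph p eps s) q ->
  exists f : classifier K X, forall i, adv_loss f (s i) <= 1 - q 0 i.
Proof.
move=> [q01 qH].
pose y i := (s i).2.
pose B (x : X) : pred 'I_n := fun i => `[< lpball p (s i).1 eps x >].
pose g x := label_max y (B x) (q 0).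
have g0 x c : 0 <= g x c.
  rewrite /g /label_max; case: label_argmax => //= i.
  by have /andP[] := q01 i.
have g1 x : \sum_c g x c <= 1.
  rewrite sum_label_max; set e := label_argmaxs _ _ _.
  (* The empty set is not a hyperedge, so a point lying in no ball is treated apart. *)
  have [->|e_neq0] := eqVneq e finset.set0; first by rewrite big_set0.
  apply: qH; split; first by rewrite card_gt0.
    move=> i j ie je; apply: contra => /eqP yij.
    by apply/eqP; exact: (label_argmaxs_inj y (B x) (q 0)) ie je yij.
  by exists x => i /label_argmaxs_sub/asboolP.
exists (fun x => complete_distr y0 (g x) (g0 x) (g1 x)) => i.
apply: adv_loss_le => x xi; rewrite expect_neq lerB //.
apply: le_trans (complete_distr_ge _ _ _ _ _).
by apply: (label_max_ge y (B x)); exact/asboolP.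
Qed.

End Packing.

Theorem theorem3p2 (R : realType) (d K : nat) (X : set 'rV[R]_d)
    (p : \bar R) (hp : (1 < p)%E) (eps : R) (heps : 0 < eps)
    (mu : fin_distr R (X * 'I_K)) :
  1 - optimal_adv_risk (@F_rand R d K X) p mu eps =
  FP (conflict_hypergraph p eps (supp mu)) (probs mu).
Proof.
have eps0 := ltW heps.
set H := conflict_hypergraph _ _ _.
have [[q Qq FPq] FPmax] := FP_max H (probs mu).
have [w0 w1] := probs_simplex mu.
(* Total mass 1 turns the weight of the packing [1 - a] into one minus the expectation of [a]. *)
have sum1B (a : 'I_(supp_size mu) -> R) :
    \sum_i probs mu 0 i * (1 - a i) = 1 - \sum_i probs mu 0 i * a i.
  by rewrite -[X in X - _]w1 -sumrB; apply: eq_bigr => i _; rewrite mulrBr mulr1.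
have lb f : 1 - FP H (probs mu) <= adv_risk p mu eps f.
  have := FPmax _ (Qfrac_adv_loss hp eps0 f (supp mu)).
  under eq_bigr do rewrite mxE.
  by rewrite sum1B lerBlDr addrC -lerBlDr.
(* Masses summing to 1 force a support point, whose label receives the missing mass. *)
have [i0] : inhabited 'I_(supp_size mu).
  case: (pickP 'I_(supp_size mu)) => [//|no].
  by move: w1; rewrite big_pred0 // => /esym/eqP; rewrite oner_eq0.
have [f fq] := classifier_of_packing hp eps0 _ (supp mu i0).2 _ Qq.
suff -> : optimal_adv_risk (@F_rand R d K X) p mu eps = 1 - FP H (probs mu).
  by rewrite opprB addrC subrK.
apply/eqP; rewrite eq_le; apply/andP; split; last first.
  by apply: lb_le_inf => [|_ [h _ <-]]; [exists (adv_risk p mu eps f), f|exact: lb].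
(* The classifier built from the optimal packing [q] attains the lower bound [lb]. *)
apply: (@le_trans _ _ (adv_risk p mu eps f)).
  apply: ge_inf; last by exists f.
  by exists (1 - FP H (probs mu)) => _ [h _ <-].
rewrite FPq -sum1B; apply: ler_sum => i _; apply: ler_wpM2l => //.
exact: fq.
Qed.
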